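(* Let $\mathbb P,\mathbb Q\in\mathcal P(\mathbb R^n)$, $\varepsilon_1,\varepsilon_2\ge0$, and let $c:\mathbb R^n\to\mathbb R_{\ge0}$ be a translation-invariant transportation cost (the cost of moving $x_1$ to $x_2$ being $c(x_1-x_2)$) for which there is $p\ge1$ such that $c^{1/p}$ satisfies the triangle inequality $c^{1/p}(x_1-x_3)\le c^{1/p}(x_1-x_2)+c^{1/p}(x_2-x_3)$ for all $x_1,x_2,x_3\in\mathbb R^n$. Then $$\mathbb B_{\varepsilon_1}^c(\mathbb P)\ast\mathbb B_{\varepsilon_2}^c(\mathbb Q)\subset\mathbb B^c_{(\varepsilon_1^{1/p}+\varepsilon_2^{1/p})^p}(\mathbb P\ast\mathbb Q).$$
   Context: $\mathcal P(\mathbb R^n)$ is the set of Borel probability distributions on $\mathbb R^n$. The convolution $\mathbb P\ast\mathbb Q$ is the distribution of $x+y$ for independent $x\sim\mathbb P$, $y\sim\mathbb Q$; for sets, $S_1\ast S_2=\{\mathbb P'\ast\mathbb Q':\mathbb P'\in S_1,\mathbb Q'\in S_2\}$. Transportation costs are non-negative and lower semi-continuous. $W_c(\mathbb P,\mathbb Q)=\inf_{\gamma\in\Gamma(\mathbb P,\mathbb Q)}\int c(x_1-x_2)\,d\gamma(x_1,x_2)$, where $\Gamma(\mathbb P,\mathbb Q)$ is the set of couplings of $\mathbb P$ and $\mathbb Q$, and $\mathbb B_\varepsilon^c(\mathbb P)=\{\mathbb Q\in\mathcal P(\mathbb R^n):W_c(\mathbb P,\mathbb Q)\le\varepsilon\}$.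 *)

(* Defs.v *)
From HB Require Import structures.
From mathcomp Require Import all_boot all_order all_algebra.
From mathcomp Require Import all_classical all_reals all_analysis.

Set Implicit Arguments.
Unset Strict Implicit.
Unset Printing Implicit Defensive.

Import Order.TTheory GRing.Theory Num.Theory.
Import numFieldNormedType.Exports.

Local Open Scope classical_set_scope.
Local Open Scope ring_scope.

(* The real vector space 'rV[R]_n with its usual topology, made a measurable
   type by its Borel sigma-algebra. *)
Definition Rn (R : realType) (n : nat) : Type := 'rV[R]_n.

HB.instance Definition _ (R : realType) (n : nat) :=
  NormedModule.copy (Rn R n) 'rV[R]_n.
HB.instance Definition _ (R : realType) (n : nat) :=
  Measurable.copy (Rn R n) (g_sigma_algebraType (@open 'rV[R]_n)).

Section borel.
Context {R : realType} {n : nat}.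
Implicit Types U : set (Rn R n).

Lemma open_measurable_Rn U : open U -> measurable U.
Proof. by move=> oU; exact: sub_sigma_algebra. Qed.

Lemma measurable_fun_to_Rn d (T : measurableType d) (f : T -> Rn R n) :
  (forall U, open U -> measurable (f @^-1` U)) -> measurable_fun setT f.
Proof.
move=> mf.
apply: (@measurability _ _ _ _ setT f (@open 'rV[R]_n)) => //.
by move=> _ [U oU <-]; rewrite setTI; exact: mf.
Qed.

Lemma rational_row_near (x : Rn R n) (e : R) : 0 < e ->
  exists q : 'rV[rat]_n, ball (map_mx (@ratr R) q : Rn R n) e x.
Proof.
move=> e0.
have near_coord (j : 'I_n) : exists q : rat, ball (ratr q : R) e (x ord0 j).
  have /rat_in_itvoo[q] : x ord0 j - e < x ord0 j + e.
    by rewrite ltrBlDr -addrA ltrDl addr_gt0.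
  rewrite in_itv/= => /andP[xq qx]; exists q.
  by rewrite /ball/= ltr_distlC; apply/andP; split; rewrite ?ltrBlDr// -ltrBlDr.
have /choice[q qP] := near_coord.
exists (\row_j q j); split => // i j; rewrite ord1 !mxE; exact: qP.
Qed.

(* The product sigma-algebra on Rn * Rn contains the Borel sigma-algebra of
   the product topology. *)
Lemma open_measurable_Rn2 (W : set (Rn R n * Rn R n)) : open W -> measurable W.
Proof.
move=> oW.
pose c (q : 'rV[rat]_n) : Rn R n := map_mx (@ratr R) q.
pose box (t : 'rV[rat]_n * 'rV[rat]_n * nat) : set (Rn R n * Rn R n) :=
  ball (c t.1.1) t.2.+1%:R^-1 `*` ball (c t.1.2) t.2.+1%:R^-1.
pose F t := if `[< box t `<=` W >] then box t else set0.
rewrite (_ : W = \bigcup_t F t).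
  apply: countable_bigcupT_measurable => // t; rewrite /F; case: ifP => // _.
  by apply: measurableX; apply: open_measurable_Rn; exact: ball_open.
apply/seteqP; split => [[x y] Wxy|z [t _]]; last first.
  by rewrite /F; case: asboolP => // + tz; exact.
have /nbhs_ballP[e /= e0 eW] : nbhs (x, y) W by exact: open_nbhs_nbhs.
have e20 : 0 < e / 2 by rewrite divr_gt0.
pose k := Num.truncn (e / 2)^-1.
have ke : k.+1%:R^-1 < e / 2.
  by rewrite -[ltRHS]invrK ltf_pV2 ?posrE ?invr_gt0// truncnS_gt.
have k0 : (0 : R) < k.+1%:R^-1 by rewrite invr_gt0.
have [qx qxP] := rational_row_near x k0.
have [qy qyP] := rational_row_near y k0.
exists (qx, qy, k) => //; rewrite /F; case: asboolP => [_|]; first by split.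
case=> -[x' y'] [/= x'P y'P]; apply: eW; split => /=.
- apply: (@le_ball _ _ _ (k.+1%:R^-1 + k.+1%:R^-1)).
    by rewrite [leRHS]splitr lerD// ltW.
  by apply: ball_triangle x'P; exact: ball_sym.
- apply: (@le_ball _ _ _ (k.+1%:R^-1 + k.+1%:R^-1)).
    by rewrite [leRHS]splitr lerD// ltW.
  by apply: ball_triangle y'P; exact: ball_sym.
Qed.

Definition addRn (z : Rn R n * Rn R n) : Rn R n := z.1 + z.2.

Lemma measurable_addRn : measurable_fun setT addRn.
Proof.
apply: measurable_fun_to_Rn => U oU; apply: open_measurable_Rn2.
by apply: open_comp oU => z _; exact: add_continuous.
Qed.

HB.instance Definition _ :=
  isMeasurableFun.Build _ _ _ _ addRn measurable_addRn.

End borel.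

Section transport.
Context {R : realType} {n : nat}.
Implicit Types (P Q : probability (Rn R n) R) (c : Rn R n -> R).

(* The law of x + y under the product measure, i.e. for independent x ~ P and
   y ~ Q. *)
Definition convolution P Q : probability (Rn R n) R :=
  distribution (P \x Q)%E addRn.

Definition convolution_set (S1 S2 : set (probability (Rn R n) R)) :
    set (probability (Rn R n) R) :=
  [set convolution P Q | P in S1 & Q in S2].

(* Marginals are compared on measurable sets only: values of a measure outside
   the sigma-algebra carry no information. *)
Definition couplings P Q : set (probability (Rn R n * Rn R n)%type R) :=
  [set gamma | forall A : set (Rn R n), measurable A ->
    pushforward gamma fst A = P A /\ pushforward gamma snd A = Q A].

Definition transport_cost c P Q : \bar R :=
  ereal_inf [set (\int[gamma]_z (c (z.1 - z.2))%:E)%E | gamma in couplings P Q].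

Definition transport_ball c (eps : R) P : set (probability (Rn R n) R) :=
  [set Q | (transport_cost c P Q <= eps%:E)%E].

End transport.

(* Main.v *)
From HB Require Import structures.
Require Import Defs.
From mathcomp Require Import all_boot all_order all_algebra.
From mathcomp Require Import all_classical all_reals all_analysis.
From mathcomp Require Import measurable_realfun.

Set Implicit Arguments.
Unset Strict Implicit.
Unset Printing Implicit Defensive.

Import Order.TTheory GRing.Theory Num.Theory.
Import numFieldNormedType.Exports.

Local Open Scope classical_set_scope.
Local Open Scope ring_scope.

(** Nearly optimal transport plans add up. Let gamma1 couple P with P' and
    gamma2 couple Q with Q'; draw (x1, x2) ~ gamma1 and (y1, y2) ~ gamma2
    independently. Then x1 and y1 are independent, and so are x2 and y2, hence
    (x1 + y1, x2 + y2) is a coupling of P * Q with P' * Q'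
    ([add_couplingsP]). The displacement of this coupling is
    (x1 - x2) + (y1 - y2), so by the triangle inequality for c^(1/p) its
    p-th root cost is pointwise at most c^(1/p)(x1 - x2) + c^(1/p)(y1 - y2).
    Minkowski's inequality in L^p(gamma1 x gamma2) turns this pointwise bound
    into one between p-th roots of expected costs. Each function on the right
    depends on one factor of the product only, so its L^p norm is the one
    computed from gamma1, resp. gamma2, alone
    ([minkowski_product_probability]).

    The infimum defining W_c may not be attained, so the argument is run with
    couplings whose p-th root costs exceed eps1^(1/p) and eps2^(1/p) by at most
    e/2 each ([transport_ball_coupling]), and e is arbitrary. The slack is put
    on the p-th roots rather than on the costs because it is there that it
    adds up and can be removed at once. *)

(** * Products of probability measures *)

Section product_probability.
Context {R : realType}.
Local Open Scope ereal_scope.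

(** Images of independent variables are independent: both sides agree on
    rectangles, and a product measure is determined by its values there. The
    hypotheses compare measures on measurable sets only, which is the form
    in which the marginals of a coupling are known. *)
Lemma product_probability_pushforward d1 d2 d3 d4
    (S1 : measurableType d1) (S2 : measurableType d2)
    (T1 : measurableType d3) (T2 : measurableType d4)
    (P1 : probability S1 R) (P2 : probability S2 R)
    (Q1 : probability T1 R) (Q2 : probability T2 R)
    (f1 : S1 -> T1) (f2 : S2 -> T2) :
  measurable_fun setT f1 -> measurable_fun setT f2 ->
  (forall A, measurable A -> P1 (f1 @^-1` A) = Q1 A) ->
  (forall A, measurable A -> P2 (f2 @^-1` A) = Q2 A) ->
  forall X, measurable X ->
    (P1 \x P2) ((fun z => (f1 z.1, f2 z.2)) @^-1` X) = (Q1 \x Q2) X.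
Proof.
move=> mf1 mf2 f1PQ f2PQ X mX.
pose f (z : S1 * S2) := (f1 z.1, f2 z.2).
have mf : measurable_fun setT f.
  by apply: measurable_fun_pair; apply: measurableT_comp.
pose mf_mixin := isMeasurableFun.Build _ _ _ _ _ mf.
pose F : {mfun _ >-> _} := HB.pack f mf_mixin.
apply/esym; apply: (@product_measure_unique _ _ _ _ _ Q1 Q2
  (distribution (P1 \x P2) F)) => // A B mA mB.
have mpre d d' (S : measurableType d) (T : measurableType d') (h : S -> T) E :
    measurable_fun setT h -> measurable E -> measurable (h @^-1` E).
  by move=> mh mE; rewrite -[_ @^-1` _]setTI; exact: mh.
transitivity (P1 (f1 @^-1` A) * P2 (f2 @^-1` B)).
  by rewrite -product_measure1E//; exact: mpre.
by congr (_ * _); [exact: f1PQ|exact: f2PQ].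
Qed.

Section marginals.
Context d1 d2 (T1 : measurableType d1) (T2 : measurableType d2).
Context (P1 : probability T1 R) (P2 : probability T2 R).

Lemma ge0_integral_product_fst (f : T1 -> \bar R) :
  measurable_fun setT f -> (forall x, 0 <= f x) ->
  \int[P1 \x P2]_z f z.1 = \int[P1]_x f x.
Proof.
move=> mf f0.
transitivity (\int[pushforward (P1 \x P2) fst]_x f x).
  by rewrite (ge0_integral_pushforward measurable_fst).
apply: eq_measure_integral => A mA _.
transitivity ((P1 \x P2) (A `*` [set: T2])).
  rewrite /= /pushforward; congr product_measure1.
  by apply/seteqP; split=> z //= -[].
rewrite -[RHS]mule1; transitivity (P1 A * P2 setT).
  exact: product_measure1E.
by congr (_ * _); exact: probability_setT.
Qed.

Lemma ge0_integral_product_snd (f : T2 -> \bar R) :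
  measurable_fun setT f -> (forall x, 0 <= f x) ->
  \int[P1 \x P2]_z f z.2 = \int[P2]_x f x.
Proof.
move=> mf f0.
transitivity (\int[pushforward (P1 \x P2) snd]_x f x).
  by rewrite (ge0_integral_pushforward measurable_snd).
apply: eq_measure_integral => A mA _.
transitivity ((P1 \x P2) ([set: T1] `*` A)).
  rewrite /= /pushforward; congr product_measure1.
  by apply/seteqP; split=> z //= -[].
rewrite -[RHS]mul1e; transitivity (P1 setT * P2 A).
  exact: product_measure1E.
by congr (_ * _); exact: probability_setT.
Qed.

(** Minkowski's inequality for h^(1/p) <= f^(1/p) + g^(1/p) where the two
    terms on the right depend on separate coordinates: the norms in
    L^p(P1 x P2) of functions of a single coordinate reduce to norms over the
    corresponding marginal. *)
Lemma minkowski_product_probability (h : T1 * T2 -> R) (f : T1 -> R)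
    (g : T2 -> R) (p : R) : (1 <= p)%R ->
  measurable_fun setT h -> measurable_fun setT f -> measurable_fun setT g ->
  (forall z, 0 <= h z)%R -> (forall x, 0 <= f x)%R -> (forall y, 0 <= g y)%R ->
  (forall z, h z `^ p^-1 <= f z.1 `^ p^-1 + g z.2 `^ p^-1)%R ->
  (\int[P1 \x P2]_z (h z)%:E) `^ p^-1 <=
  (\int[P1]_x (f x)%:E) `^ p^-1 + (\int[P2]_y (g y)%:E) `^ p^-1.
Proof.
move=> p1 mh mf mg h0 f0 g0 hfg.
have p0 : (0 < p)%R by exact: lt_le_trans p1.
have rootK (a : R) : (0 <= a)%R -> ((`|a `^ p^-1| `^ p) = a)%R.
  by move=> a0; rewrite ger0_norm ?powR_ge0// -powRrM mulVf ?gt_eqF// powRr1.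
have rootM d (T : measurableType d) (u : T -> R) :
    measurable_fun setT u -> measurable_fun setT (fun x => u x `^ p^-1)%R.
  by move=> mu; exact: (measurableT_comp (measurable_powR _) mu).
have LnormE (u : T1 * T2 -> R) : (forall z, 0 <= u z)%R ->
    'N[P1 \x P2]_p%:E[EFin \o (fun z => u z `^ p^-1)%R] =
    (\int[P1 \x P2]_z (u z)%:E) `^ p^-1.
  move=> u0; rewrite unlock; congr (_ `^ _).
  by apply: eq_integral => z _ /=; rewrite rootK.
rewrite -(ge0_integral_product_fst (f := EFin \o f))//=; last first.
  exact/measurable_EFinP.
rewrite -(ge0_integral_product_snd (f := EFin \o g))//=; last first.
  exact/measurable_EFinP.
have mf1 : measurable_fun setT (fun z : T1 * T2 => f z.1).
  exact: measurableT_comp.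
have mg2 : measurable_fun setT (fun z : T1 * T2 => g z.2).
  exact: measurableT_comp.
rewrite -(LnormE (fun z => f z.1))// -(LnormE (fun z => g z.2))//.
apply: le_trans (minkowski_EFin _ (rootM _ _ _ mf1)
  (rootM _ _ _ mg2) p1).
rewrite unlock; apply: gt0_ler_poweR.
- by rewrite invr_ge0 ltW.
- by rewrite in_itv/= leey andbT integral_ge0// => z _; rewrite lee_fin.
- by rewrite in_itv/= leey andbT integral_ge0// => z _; rewrite poweR_ge0.
apply: ge0_le_integral => //.
- by move=> z _; rewrite lee_fin.
- exact/measurable_EFinP.
- apply/measurable_EFinP.
  apply: (measurableT_comp (measurable_powR _)).
  apply: measurableT_comp => //; apply: measurable_funD; exact: rootM.
move=> z _; rewrite lee_fin -[leLHS]rootK// ge0_ler_powR ?nnegrE ?(ltW p0)//.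
by rewrite !ger0_norm ?addr_ge0 ?powR_ge0.
Qed.

End marginals.
End product_probability.

(** * Couplings of convolutions *)

Section couplings_of_convolutions.
Context {R : realType} {n : nat}.
Implicit Types (P Q : probability (Rn R n) R) (c : Rn R n -> R).

(** The superlevel sets of a lower semicontinuous function are open, and rays
    generate the Borel sets of the extended reals. *)
Lemma lower_semicontinuous_measurable_Rn (f : Rn R n -> \bar R) :
  lower_semicontinuous f -> measurable_fun setT f.
Proof.
move=> /lower_semicontinuousP fopen.
apply: (measurability _ (ErealGenOInfty.measurableE R)).
move=> /= _ [_ [a ->]] <-; apply: measurableI => //; apply: open_measurable_Rn.
by rewrite preimage_itvoy; exact: fopen.
Qed.

Definition subRn (z : Rn R n * Rn R n) : Rn R n := z.1 - z.2.

Lemma measurable_subRn : measurable_fun setT subRn.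
Proof.
apply: measurable_fun_to_Rn => U oU; apply: open_measurable_Rn2.
by apply: open_comp oU => z _; exact: sub_continuous.
Qed.

Definition add_pairs (z : (Rn R n * Rn R n) * (Rn R n * Rn R n)) :
    Rn R n * Rn R n :=
  (z.1.1 + z.2.1, z.1.2 + z.2.2).

Lemma measurable_add_pairs : measurable_fun setT add_pairs.
Proof.
have mD d (T : measurableType d) (f g : T -> Rn R n) :
    measurable_fun setT f -> measurable_fun setT g ->
    measurable_fun setT (fun z => f z + g z).
  move=> mf mg.
  exact: (measurableT_comp measurable_addRn (measurable_fun_pair mf mg)).
by apply: measurable_fun_pair; apply: mD; exact: measurableT_comp.
Qed.

HB.instance Definition _ :=
  isMeasurableFun.Build _ _ _ _ add_pairs measurable_add_pairs.

Definition add_couplings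
    (gamma1 gamma2 : probability (Rn R n * Rn R n)%type R) :
    probability (Rn R n * Rn R n)%type R :=
  distribution (gamma1 \x gamma2)%E add_pairs.

(** Each marginal of the sum is the law of the sum of the corresponding
    marginals, which are independent because gamma1 and gamma2 are combined
    as a product. *)
Lemma add_couplingsP P1 P2 Q1 Q2 gamma1 gamma2 :
  couplings P1 Q1 gamma1 -> couplings P2 Q2 gamma2 ->
  couplings (convolution P1 P2) (convolution Q1 Q2)
            (add_couplings gamma1 gamma2).
Proof.
move=> cpl1 cpl2 A mA.
have mAA : measurable (addRn @^-1` A).
  by rewrite -[_ @^-1` _]setTI; exact: measurable_addRn.
split.
- apply: (product_probability_pushforward (Q1 := P1) (Q2 := P2)
    measurable_fst measurable_fst _ _ mAA).
  + by move=> B /cpl1[].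
  + by move=> B /cpl2[].
- apply: (product_probability_pushforward (Q1 := Q1) (Q2 := Q2)
    measurable_snd measurable_snd _ _ mAA).
  + by move=> B /cpl1[].
  + by move=> B /cpl2[].
Qed.

Lemma transport_cost_ge0 c P Q :
  (forall x, 0 <= c x) -> (0 <= transport_cost c P Q)%E.
Proof.
move=> c0; apply: le_ereal_inf_tmp => _ [g _ <-].
by apply: integral_ge0 => z _; rewrite lee_fin.
Qed.

(** Test the infimum defining the cost on the left against the sum of the two
    couplings: its displacement is the sum of their displacements, so
    Minkowski's inequality applies. *)
Lemma transport_cost_convolution_le_couplings c (p : R) P1 P2 Q1 Q2
    gamma1 gamma2 :
  (forall x, 0 <= c x) -> measurable_fun setT c -> 1 <= p ->
  (forall x y, c (x + y) `^ p^-1 <= c x `^ p^-1 + c y `^ p^-1) ->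
  couplings P1 Q1 gamma1 -> couplings P2 Q2 gamma2 ->
  (transport_cost c (convolution P1 P2) (convolution Q1 Q2) `^ p^-1 <=
   (\int[gamma1]_z (c (z.1 - z.2))%:E) `^ p^-1 +
   (\int[gamma2]_z (c (z.1 - z.2))%:E) `^ p^-1)%E.
Proof.
move=> c0 mc p1 cD cpl1 cpl2.
have mcB : measurable_fun setT (fun z : Rn R n * Rn R n => c (z.1 - z.2)).
  exact: (measurableT_comp mc measurable_subRn).
have mcBD : measurable_fun setT
    (fun z => c ((add_pairs z).1 - (add_pairs z).2)).
  exact: (measurableT_comp mcB measurable_add_pairs).
pose h z := c ((add_pairs z).1 - (add_pairs z).2).
have h_le z : h z `^ p^-1 <=
    c (z.1.1 - z.1.2) `^ p^-1 + c (z.2.1 - z.2.2) `^ p^-1.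
  by rewrite /h opprD addrACA.
have := minkowski_product_probability gamma1 gamma2 p1 mcBD mcB mcB
  (fun=> c0 _) (fun=> c0 _) (fun=> c0 _) h_le.
apply: le_trans; apply: gt0_ler_poweR.
- by rewrite invr_ge0 (le_trans _ p1).
- by rewrite in_itv/= leey andbT transport_cost_ge0.
- by rewrite in_itv/= leey andbT integral_ge0// => z _; rewrite lee_fin.
apply: ereal_inf_lbound; exists (add_couplings gamma1 gamma2).
  exact: add_couplingsP.
rewrite (ge0_integral_pushforward measurable_add_pairs)//.
  exact/measurable_EFinP.
by move=> z _; rewrite lee_fin.
Qed.

(** The infimum W_c(P, Q) may not be attained; the gap between eps and s^p is
    what leaves room for an actual coupling. *)
Lemma transport_ball_coupling c (eps p s : R) P Q :
  0 < p -> 0 <= eps -> (forall x, 0 <= c x) ->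
  transport_ball c eps P Q -> eps `^ p^-1 < s ->
  exists2 gamma, couplings P Q gamma &
    ((\int[gamma]_z (c (z.1 - z.2))%:E) `^ p^-1 <= s%:E)%E.
Proof.
move=> p0 eps0 c0 PQ eps_s.
have s0 : 0 <= s by apply: le_trans (ltW eps_s); exact: powR_ge0.
have eps_sp : eps < s `^ p.
  rewrite -[eps]powRr1// -(mulVf (lt0r_neq0 p0)) powRrM.
  by rewrite gt0_ltr_powR// nnegrE powR_ge0.
have /ereal_inf_lt[_ [gamma cpl <-] lt_s] :
    (transport_cost c P Q < (s `^ p)%:E)%E.
  by apply: le_lt_trans PQ _; rewrite lte_fin.
exists gamma => //.
rewrite (_ : s%:E = (s `^ p)%:E `^ p^-1)%E; last first.
  by rewrite poweR_EFin -powRrM mulfV ?gt_eqF// powRr1.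
apply: gt0_ler_poweR; rewrite ?in_itv/= ?leey ?andbT ?invr_ge0 ?(ltW p0)//.
- by apply: integral_ge0 => z _; rewrite lee_fin.
- by rewrite lee_fin powR_ge0.
- exact: ltW.
Qed.

End couplings_of_convolutions.

Unset Implicit Arguments.

Theorem theorem11 (R : realType) (n : nat) (P Q : probability (Rn R n) R)
    (eps1 eps2 : R) (c : Rn R n -> R) (p : R)
    (eps1_ge0 : 0 <= eps1) (eps2_ge0 : 0 <= eps2)
    (c_ge0 : forall x, 0 <= c x)
    (c_lsc : lower_semicontinuous (fun x => (c x)%:E))
    (p_ge1 : 1 <= p)
    (c_triangle : forall x1 x2 x3 : Rn R n,
      c (x1 - x3) `^ p^-1 <= c (x1 - x2) `^ p^-1 + c (x2 - x3) `^ p^-1) :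
  convolution_set (transport_ball c eps1 P) (transport_ball c eps2 Q) `<=`
  transport_ball c ((eps1 `^ p^-1 + eps2 `^ p^-1) `^ p) (convolution P Q).
Proof.
move=> _ [P' PP' [Q' QQ' <-]].
have p0 : 0 < p by exact: lt_le_trans p_ge1.
have mc : measurable_fun setT c.
  by apply/measurable_EFinP; exact: lower_semicontinuous_measurable_Rn.
(* The triangle inequality at (x + y, y, 0) is subadditivity of c^(1/p). *)
have cD x y : c (x + y) `^ p^-1 <= c x `^ p^-1 + c y `^ p^-1.
  by have := c_triangle (x + y) y 0; rewrite !subr0 addrK.
rewrite /transport_ball/=; set W := transport_cost _ _ _.
have W0 : (0 <= W)%E by exact: transport_cost_ge0.
suff : (W `^ p^-1 <= (eps1 `^ p^-1 + eps2 `^ p^-1)%:E)%E.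
  move=> Wle; rewrite -[W]poweRe1// -(mulVf (lt0r_neq0 p0)) poweRrM -poweR_EFin.
  apply: gt0_ler_poweR; rewrite ?in_itv/= ?leey ?andbT ?(ltW p0) ?poweR_ge0//.
  by rewrite lee_fin addr_ge0 ?powR_ge0.
(* The slack e is shared equally between the two couplings. *)
apply/lee_addgt0Pr => e e0.
have lt1 (x : R) : x < x + e / 2 by rewrite ltrDl divr_gt0.
have [g1 cpl1 le1] := transport_ball_coupling p0 eps1_ge0 c_ge0 PP' (lt1 _).
have [g2 cpl2 le2] := transport_ball_coupling p0 eps2_ge0 c_ge0 QQ' (lt1 _).
rewrite -EFinD [in leRHS](splitr e) addrACA EFinD.
apply: le_trans (leeD le1 le2).
exact: transport_cost_convolution_le_couplings.
Qed.
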